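(* Let $m,n\ge2$ be integers with $m$ even, and let $\mathbf{x}^n=\{x^n_k: k=1,2,\dots\}$ be a (real-valued, discrete) stochastic process with period $n$. Then its $m$th order moment tensor $M_m(\mathbf{x}^n)$ is positive semi-definite.
   Context: A discrete stochastic process $\mathbf{x}^n=\{x^n_k:k=1,2,\dots\}$ has period $n$ if $x^n_k=x^n_j$ whenever $k\equiv j\pmod n$. Its joint moments are $\mathrm{Mom}(x^n_{i_1},\dots,x^n_{i_m})=E\{x^n_{i_1}\cdots x^n_{i_m}\}$; these expectations are assumed to exist (be finite). Because of periodicity, the $m$th order moment of the process is expressed by the $m$th order $n$-dimensional real tensor $M_m(\mathbf{x}^n)=\left[\mathrm{Mom}(x^n_{i_1},\dots,x^n_{i_m})\right]_{i_1,\dots,i_m=1}^n$. For even $m$, an $m$th order $n$-dimensional real tensor $\mathcal{M}=(\mu_{i_1\cdots i_m})$ is positive semi-definite if $\sum_{i_1,\dots,i_m=1}^n\mu_{i_1\cdots i_m}\alpha_{i_1}\cdots\alpha_{i_m}\ge0$ for all $\alpha\in\mathbb{R}^n$. *)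

(* Defs.v *)
From mathcomp Require Import all_boot all_order all_algebra.
From mathcomp Require Import all_classical all_reals all_analysis.

Set Implicit Arguments.
Unset Strict Implicit.
Unset Printing Implicit Defensive.

Import Order.TTheory GRing.Theory Num.Theory.
Import numFieldNormedType.Exports.

Local Open Scope classical_set_scope.
Local Open Scope ring_scope.

(* The indices {1,...,n} are represented by 'I_n = {0,...,n-1}. *)
Definition tensor (R : realType) (m n : nat) : Type :=
  {ffun {ffun 'I_m -> 'I_n} -> R}.

(* The form associated with M, evaluated at every a in R^n, is nonnegative.
   The parity of m is not part of the predicate; the notion is only of
   interest for even m. *)
Definition psd_tensor (R : realType) (m n : nat) (M : tensor R m n) : Prop :=
  forall a : 'rV[R]_n,
    0 <= \sum_(i : {ffun 'I_m -> 'I_n}) M i * \prod_(j < m) a ord0 (i j).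

(* A process x_1, x_2, ... is represented by a sequence indexed from 0: x k
   stands for x_(k+1).  The shift does not affect congruences between indices. *)
Definition process (d : measure_display) (T : measurableType d) (R : realType)
    (P : probability T R) : Type :=
  nat -> {RV P >-> R}.

(* Random variables are equal when they agree almost surely. *)
Definition has_period (d : measure_display) (T : measurableType d)
    (R : realType) (P : probability T R) (n : nat) (x : process P) : Prop :=
  forall k j : nat, k = j %[mod n] -> {ae P, forall w, x k w = x j w}.

Definition finite_moments (d : measure_display) (T : measurableType d)
    (R : realType) (P : probability T R) (m : nat) (x : process P) : Prop :=
  forall i : 'I_m -> nat,
    P.-integrable [set: T] (fun w => (\prod_(j < m) x (i j) w)%:E).

(* [fine] turns the extended-real expectation into a real number; it only
   discards information when the expectation is infinite. *)
Definition Mom (d : measure_display) (T : measurableType d) (R : realType)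
    (P : probability T R) (m : nat) (X : 'I_m -> {RV P >-> R}) : R :=
  fine ('E_P[fun w => (\prod_(j < m) X j w)%R])%E.

Definition moment_tensor (d : measure_display) (T : measurableType d)
    (R : realType) (P : probability T R) (m n : nat) (x : process P) :
    tensor R m n :=
  [ffun i : {ffun 'I_m -> 'I_n} => Mom (fun j : 'I_m => x (i j))].

(* Main.v *)
(* The form evaluated at [a] is the expectation of the even power
   [(\sum_k a_k x_k) ^+ m]. *)
Require Import Defs.
From mathcomp Require Import all_boot all_order all_algebra.
From mathcomp Require Import all_classical all_reals all_analysis.

Import Order.TTheory GRing.Theory Num.Theory.

(** Expanding the [m]-th power of the sum of the [a_k x_k] gives one monomial per index map [i],
    whose expectation is the matching term of the form. Finiteness of the moments lets
    [Rintegral_sum] exchange sum and expectation, and an even power is pointwise nonnegative. *)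

Lemma Rintegral_sum (d : measure_display) (T : measurableType d)
    (R : realType) (mu : {measure set T -> \bar R}%R) (D : set T)
    (I : Type) (s : seq I) (Q : pred I) (f : I -> T -> R) :
  measurable D -> (forall i, mu.-integrable D (EFin \o f i)) ->
  (\int[mu]_(w in D) (\sum_(i <- s | Q i) f i w) =
   \sum_(i <- s | Q i) \int[mu]_(w in D) f i w)%R.
Proof.
move=> mD intf; rewrite /Rintegral.
under eq_integral do rewrite -sumEFin.
rewrite integral_sum// -sum_fine// => i _.
exact: (integrable_fin_num mD (intf i)).
Qed.

Theorem proposition1 (d : measure_display) (T : measurableType d)
    (R : realType) (P : probability T R) (m n : nat) (x : process P)
    (hm : (2 <= m)%N) (hn : (2 <= n)%N) (m_even : ~~ odd m)
    (x_period : has_period n x) (x_moments : finite_moments m x) :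
  psd_tensor (moment_tensor m n x).
Proof.
move=> a.
pose X (i : {ffun 'I_m -> 'I_n}) w : R := (\prod_(j < m) x (i j) w)%R.
pose c (i : {ffun 'I_m -> 'I_n}) : R := (\prod_(j < m) a ord0 (i j))%R.
have intX i : P.-integrable setT (EFin \o X i).
  exact: (x_moments (fun j => i j)).
have intXc i : P.-integrable setT (EFin \o (fun w => X i w * c i)%R).
  exact: integrableZr (intX i).
have -> : (\sum_i moment_tensor m n x i * \prod_(j < m) a ord0 (i j) =
    \int[P]_w (\sum_i X i w * c i))%R.
  rewrite Rintegral_sum//; apply: eq_bigr => i _.
  (* Once the expectation is unlocked, [Mom] is the real-valued integral by definition. *)
  by rewrite RintegralZr// ffunE /Mom unlock.
apply: Rintegral_ge0 => w _.
have -> : (\sum_i X i w * c i = (\sum_(k < n) x k w * a ord0 k) ^+ m)%R.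
  (* The power becomes a constant product over ['I_m], so that distributivity yields a sum over all
     maps ['I_m -> 'I_n]. *)
  rewrite -[in RHS](card_ord m) -prodr_const bigA_distr_bigA /=.
  by apply: eq_bigr => i _; rewrite /X /c -big_split.
exact: exprn_even_ge0.
Qed.
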